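(* Let $G$ be a group and $X$ a $G$-set such that: (i) $\mathrm{Conj}_G(X)$ is infinite; (ii) there exists $[H_0]\in\mathrm{Conj}_G(X)$ such that there are infinitely many $[K_\alpha]\in\mathrm{Conj}_G(X)$ with $[H_0]<[K_\alpha]$. Then the monoid $\mathrm{End}_G(X)$ is not finitely generated.
   Context: $\mathrm{End}_G(X)$ is the monoid (under composition) of $G$-equivariant functions $X\to X$. $[H]$ is the $G$-conjugacy class of a subgroup $H\le G$, and $\mathrm{Conj}_G(X)=\{[G_x]:x\in X\}$ where $G_x$ is the stabilizer of $x$. On conjugacy classes of subgroups, $[H]\le[K]$ means that there exists $g\in G$ with $H\le g^{-1}Kg$, and $[H]<[K]$ means $[H]\le[K]$ and $[H]\ne[K]$. *)

(* Defs.v *)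
From HB Require Import structures.
From mathcomp Require Import all_boot.
From mathcomp Require Import boolp classical_sets functions cardinality.

Set Implicit Arguments.
Unset Strict Implicit.
Unset Printing Implicit Defensive.

Local Open Scope classical_set_scope.
Local Open Scope group_scope.

(* Left actions of an arbitrary group; the actions of fingroup are right
   actions of finite groups. *)
Record gaction (G : groupType) (X : Type) := GAction {
  gact :> G -> X -> X;
  gact1 : forall x, gact 1 x = x;
  gactM : forall g h x, gact (g * h) x = gact g (gact h x)
}.

Section ConjugacyClasses.
Variable G : groupType.
Implicit Types (H K : set G) (C D : set (set G)).

(* Since k ^ g = g^-1 * k * g, this is g^-1 K g. *)
Definition conjg_set K (g : G) : set G := [set k ^ g | k in K].

Definition conjg_class H : set (set G) := range (conjg_set H).

(* On classes C = [H] and D = [K] this does not depend on the chosen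
   representatives: see conjg_leP. It is only a preorder when G is infinite. *)
Definition conjg_le C D :=
  exists H K, [/\ C H, D K & exists g, H `<=` conjg_set K g].

Definition conjg_lt C D := conjg_le C D /\ C <> D.

Lemma conjg_class_refl H : conjg_class H H.
Proof.
exists 1 => //; apply/seteqP; split=> [_ [h ? <-]|h ?]; first by rewrite conjg1.
by exists h; rewrite ?conjg1.
Qed.

Lemma conjg_leP H K :
  conjg_le (conjg_class H) (conjg_class K) <->
  exists g, H `<=` conjg_set K g.
Proof.
split=> [[_ [_ [[a _ <-] [b _ <-] [g sHK]]]]|[g sHK]]; last first.
  by exists H, K; split; [exact: conjg_class_refl..|exists g].
exists (b * g * a^-1) => h Hh.
have [|_ [k Kk <-] e] := sHK (h ^ a); first by exists h.
by exists k => //; rewrite !conjgM e conjgK.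
Qed.

End ConjugacyClasses.

Section Endomorphisms.
Variables (G : groupType) (X : Type) (to : gaction G X).

Definition stab (x : X) : set G := [set g | to g x = x].

Definition Conj : set (set (set G)) := range (fun x => conjg_class (stab x)).

Record gend := GEnd {
  gend_fun :> X -> X;
  gendP : forall g x, gend_fun (to g x) = to g (gend_fun x)
}.

Lemma gend_inj (e f : gend) : (forall x, e x = f x) -> e = f.
Proof.
case: e f => e eP [f fP] /= /funext ef; move: eP fP; rewrite {}ef => eP fP.
by congr GEnd; apply: Prop_irrelevance.
Qed.

Lemma gend_idP g x : id (to g x) = to g (id x). Proof. by []. Qed.
Definition gend_id := GEnd gend_idP.

Lemma gend_compP (e f : gend) g x : (e \o f) (to g x) = to g ((e \o f) x).
Proof. by rewrite /= !gendP. Qed.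
Definition gend_comp (e f : gend) := GEnd (gend_compP e f).

Lemma gend_compA : associative gend_comp.
Proof. by move=> e f h; apply: gend_inj. Qed.

Lemma gend_comp1e : left_id gend_id gend_comp.
Proof. by move=> e; apply: gend_inj. Qed.

Lemma gend_compe1 : right_id gend_id gend_comp.
Proof. by move=> e; apply: gend_inj. Qed.

HB.instance Definition _ := gen_eqMixin gend.
HB.instance Definition _ := gen_choiceMixin gend.
HB.instance Definition _ :=
  isMonoid.Build gend gend_compA gend_comp1e gend_compe1.

End Endomorphisms.

Definition gen_submonoid (M : monoidType) (A : set M) : set M :=
  smallest (fun N : set M => monoid_closed (mem N)) A.

Definition finitely_generated_monoid (M : monoidType) :=
  exists2 A : set M, finite_set A & gen_submonoid A = [set: M].

(* Main.v *)
(* Since End_G(X) acts on orbits, the orbit of x can be sent to the orbit of y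
   exactly when some point of the latter has a stabilizer containing that of x;
   the choices for distinct orbits are independent.  Call an orbit movable if
   it can be sent to another orbit.  A finitely generated monoid is countable,
   so only finitely many orbits are movable: otherwise a diagonal argument
   produces an endomorphism outside any given countable family.  Then the
   movable orbits together with their images under the generators form a finite
   set of orbits stable under the whole monoid.  It contains the orbit of a
   point of type H_0, which however can be sent to an orbit of each of the
   infinitely many types K_alpha. *)
Require Import Defs.
From mathcomp Require Import all_boot.
From mathcomp Require Import boolp classical_sets functions cardinality.

Set Implicit Arguments.
Unset Strict Implicit.
Unset Printing Implicit Defensive.

Local Open Scope classical_set_scope.

Lemma gen_submonoid_ind (M : monoidType) (A : set M) (P : M -> Prop) :
  P 1%g -> (forall e f, P e -> P f -> P (e * f)%g) ->
  (forall a, A a -> P a) -> forall e, gen_submonoid A e -> P e.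
Proof.
move=> P1 PM PA; apply: (@smallest_sub _ _ _ P) => //.
split=> [|e f]; first exact/mem_set.
by move=> /set_mem Pe /set_mem Pf; apply/mem_set/PM.
Qed.

(** Every element is a product of generators, so it is coded by a finite list of indices into [s];
    indices out of range stand for the unit. *)
Lemma finitely_generated_countable (M : monoidType) :
  finitely_generated_monoid M -> countable [set: M].
Proof.
case=> A /finite_seqP[s ->] genA.
pose word (w : seq nat) := foldr (fun i e => nth 1%g s i * e)%g 1%g w.
have sub_word : [set: M] `<=` range word.
  rewrite -genA; apply: gen_submonoid_ind => [|_ _ [v _ <-] [w _ <-]|a /= sa].
  - by exists [::].
  - exists (v ++ w) => //; elim: v => [|i v IHv] /=; first by rewrite mul1g.
    by rewrite IHv mulgA.
  - by exists [:: index a s] => //=; rewrite mulg1 nth_index.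
apply: card_le_trans (subset_card_le sub_word) _.
exact: card_le_trans (card_image_le _ _) (countableP _).
Qed.

Section Orbits.
Variables (G : groupType) (X : Type) (to : gaction G X).
Implicit Types (x y z : X) (g h : G) (e : gend to).

Definition orb x : set X := range (to^~ x).

Definition movable x := exists2 y, stab to x `<=` stab to y & orb y <> orb x.

Lemma orb_refl x : orb x x.
Proof. by exists 1%g; rewrite ?gact1. Qed.

Lemma gactK g x : to g^-1%g (to g x) = x.
Proof. by rewrite -gactM mulVg gact1. Qed.

Lemma gactVK g x : to g (to g^-1%g x) = x.
Proof. by rewrite -gactM mulgV gact1. Qed.

Lemma orb_act g x : orb (to g x) = orb x.
Proof.
apply/seteqP; split=> _ [h _ <-].
  by exists (h * g)%g; rewrite ?gactM.
by exists (h * g^-1)%g; rewrite // gactM gactK.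
Qed.

Lemma orb_eqP x y : orb x = orb y <-> exists g, y = to g x.
Proof.
split=> [xy|[g ->]]; last by rewrite orb_act.
by have := orb_refl y; rewrite -xy => -[g _ <-]; exists g.
Qed.

Lemma image_orb e x : e @` orb x = orb (e x).
Proof.
apply/seteqP; split=> [_ [_ [g _ <-] <-]|_ [g _ <-]].
  by exists g; rewrite // gendP.
by exists (to g x); [exists g|rewrite gendP].
Qed.

Lemma gend_orb e x y : orb x = orb y -> orb (e x) = orb (e y).
Proof. by rewrite -!image_orb => ->. Qed.

Lemma stab_gend e x : stab to x `<=` stab to (e x).
Proof. by move=> g; rewrite /stab /= -gendP => ->. Qed.

Lemma gend_fix_orb e x : ~ movable x -> orb (e x) = orb x.
Proof.
move=> nmx; apply: contrapT => ex; apply: nmx.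
by exists (e x) => //; apply: stab_gend.
Qed.

Lemma stab_act g x : stab to (to g x) = conjg_set (stab to x) g^-1%g.
Proof.
apply/seteqP; split=> [h hx|_ [k kx <-]].
  exists (h ^ g)%g; last by rewrite conjgK.
  by rewrite /stab /= /conjg !gactM hx gactK.
by rewrite /stab /= /conjg invgK !gactM gactK kx.
Qed.

(** Moving a point along its orbit conjugates its stabilizer, so the class is determined by the
    orbit. *)
Lemma conjg_class_stab x : conjg_class (stab to x) = stab to @` orb x.
Proof.
apply/seteqP; split=> [_ [g _ <-]|_ [_ [g _ <-] <-]].
  by exists (to g^-1%g x); [exists g^-1%g|rewrite stab_act invgK].
by exists g^-1%g => //; rewrite stab_act.
Qed.

Lemma conjg_le_stab x y :
  conjg_le (conjg_class (stab to x)) (conjg_class (stab to y)) ->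
  exists2 z, orb z = orb y & stab to x `<=` stab to z.
Proof.
case/conjg_leP=> g sxy; exists (to g^-1%g y); first exact: orb_act.
by rewrite stab_act invgK.
Qed.

(** An equivariant map may be prescribed freely on one representative [r] of each orbit, provided
    stabilizers do not shrink; invariance of [P] carries the property to the whole orbit. *)
Lemma gend_choice (P : X -> X -> Prop) :
  (forall g x y, P x y -> P (to g x) (to g y)) ->
  (forall x, exists2 y, P x y & stab to x `<=` stab to y) ->
  exists e, forall x, P x (e x).
Proof.
move=> PG Pex.
have [[x0]|nX] := pselect (inhabited X); last by exists 1%g => x; case: nX.
have /choice[t tP] x : exists y, P x y /\ stab to x `<=` stab to y.
  by have [y] := Pex x; exists y.
have /choice[r rP] (O : set X) : exists y, forall x, O x -> O y.
  have [[x Ox]|nO] := pselect (exists x, O x); first by exists x.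
  by exists x0 => x Ox; case: nO; exists x.
have /choice[s sP] x : exists g, x = to g (r (orb x)).
  apply/orb_eqP.
  by have [g _ <-] := rP (orb x) x (orb_refl x); rewrite orb_act.
(* The value of [f] will not depend on the group element chosen by [s]: [h^-1 * g] fixes [z], hence
   also [t z]. *)
have tE g h z : to g z = to h z -> to g (t z) = to h (t z).
  move=> gh; have : stab to z (h^-1 * g)%g by rewrite /stab /= gactM gh gactK.
  move=> /(proj2 (tP z)); rewrite /stab /= gactM => {2}<-.
  by rewrite gactVK.
pose f x := to (s x) (t (r (orb x))).
have fG g x : f (to g x) = to g (f x).
  rewrite /f orb_act -gactM; apply: tE.
  by rewrite gactM -sP -(orb_act g) -sP.
exists (GEnd fG) => x /=.
by rewrite {1}[x]sP; apply: PG; have [] := tP (r (orb x)).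
Qed.

Lemma gend_to_orb x y :
  stab to x `<=` stab to y -> exists e, orb (e x) = orb y.
Proof.
move=> sxy.
have [||e eP] := @gend_choice (fun z w => orb z = orb x -> orb w = orb y).
- by move=> g z w; rewrite !orb_act.
- move=> z; have [/esym/orb_eqP[g ->]|zx] := pselect (orb z = orb x).
    exists (to g y); first by rewrite !orb_act.
    by rewrite !stab_act; apply: image_subset.
  by exists z.
by exists e; apply: eP.
Qed.

(** Diagonal argument: [c] numbers the endomorphisms and [o] enumerates distinct movable orbits. On
    the orbit [o (c e)], [d] moves exactly when [e] does not; taking [e] to be [d] is absurd. *)
Lemma finite_movable_orbits :
  countable [set: gend to] -> finite_set (orb @` movable).
Proof.
move=> /pcard_leTP[c]; apply: contrapT => /infiniteP/pcard_leP[o].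
have c_inj e f : c e = c f -> e = f by apply: inj; rewrite inE.
have o_inj m n : o m = o n -> m = n by apply: inj; rewrite inE.
have [||d dP] := @gend_choice (fun x y => forall e, orb x = o (c e) ->
  (orb (e x) = orb x <-> orb y <> orb x)).
- by move=> g x y xy e; rewrite gendP !orb_act; apply: xy.
- move=> x; have [[e [xe ex]]|xo] :=
    pselect (exists e, orb x = o (c e) /\ orb (e x) = orb x); last first.
    by exists x => // e xe; split=> // ex; case: xo; exists e.
  (* Here [e] preserves the orbit of [x], so [d] must leave it; movability is known at some [z] of
     that orbit and is transported to [x] by [g]. *)
  have [z [y szy yz] zx] : (orb @` movable) (orb x).
    by rewrite xe; apply: (@funS _ _ _ _ o).
  have [g xz] : exists g, x = to g z by apply/orb_eqP.
  exists (to g y); last by rewrite xz !stab_act; apply: image_subset.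
  move=> f; rewrite xe => /o_inj/c_inj <-.
  by rewrite -xe ex orb_act -zx.
have [x _ xd] : (orb @` movable) (o (c d)) by apply: (@funS _ _ _ _ o).
by have [] := dP x d xd; tauto.
Qed.

Lemma finite_invariant_orbits (A : set (gend to)) :
  finite_set A -> gen_submonoid A = [set: gend to] ->
  exists S : set (set X), [/\ finite_set S, orb @` movable `<=` S &
    forall e x, S (orb x) -> S (orb (e x))].
Proof.
move=> finA genA; set M := orb @` movable.
have finM : finite_set M.
  by apply/finite_movable_orbits/finitely_generated_countable; exists A.
exists (M `|` [set (e : gend to) @` O | e in A & O in M]); split.
- by rewrite finite_setU; split=> //; apply: finite_image2.
- by move=> O; left.
move=> e; have : gen_submonoid A e by rewrite genA.
elim/gen_submonoid_ind: e / => [//|e f eS fS x /fS/eS//|a Aa x Sx].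
(* A generator sends a movable orbit into the second part of the union and preserves any other
   orbit. *)
have [mx|nmx] := pselect (movable x); last by rewrite gend_fix_orb.
by right; exists a => //; exists (orb x); [exists x|rewrite image_orb].
Qed.

End Orbits.

Theorem corollary25 (G : groupType) (X : Type) (to : gaction G X)
    (Conj_inf : infinite_set (Conj to))
    (H0_inf : exists2 H0, Conj to H0 &
       infinite_set [set K | Conj to K /\ conjg_lt H0 K]) :
  ~ finitely_generated_monoid (gend to).
Proof.
case=> A finA genA.
have [S [finS MS eS]] := finite_invariant_orbits finA genA.
case: H0_inf => _ [x _ <-] [].
(* Each class above that of [x] comes from an orbit reachable from [x], hence from one in the finite
   set [S]. *)
apply: (@sub_finite_set _ _ [set stab to @` O | O in S]); last exact: finite_image.
move=> _ [[y _ <-] [sxy nxy]].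
have [z zy sxz] := conjg_le_stab sxy.
have mx : movable to x.
  by exists z => //; rewrite zy => yx; apply: nxy; rewrite !conjg_class_stab yx.
have [e ez] := gend_to_orb sxz.
exists (orb to (e x)); first by apply/eS/MS; exists x.
by rewrite ez zy conjg_class_stab.
Qed.
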